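(* Let $r\ge 1$ and $s\geq 3$ be integers with $r\geq \lfloor s/2\rfloor\, s$. Then the cylinder $P_r\,\square\, C_s$ satisfies ${\rm ip}_{p}(P_r\,\square\, C_s)={\rm ip}_{c}(P_r\,\square\, C_s)=s$.
   Context: $P_r$ is the path on $r$ vertices, $C_s$ the cycle on $s$ vertices, and $\square$ the Cartesian product. A path is isometric if its length equals the distance between its endpoints; single vertices count as paths. ${\rm ip}_{c}(H)$ (resp. ${\rm ip}_{p}(H)$) is the minimum number of isometric paths of $H$ whose vertex sets cover (resp. partition) $V(H)$. *)

(* Defs.v *)
From mathcomp Require Import all_boot.

Set Implicit Arguments.
Unset Strict Implicit.
Unset Printing Implicit Defensive.

(* A graph is given by its adjacency relation on a finite vertex type. *)

Section IsometricPaths.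
Variables (T : finType) (e : rel T).

(* Least length of a walk from x to y. Shortest walks have fewer than #|T|    *)
(* edges, so the value #|T| is taken exactly when x and y are not connected.  *)
Definition dist (x y : T) : nat :=
  find (fun n => [exists p : n.-tuple T, path e x p && (last x p == y)])
       (iota 0 #|T|).

(* Paths are nonempty duplicate-free vertex sequences; [:: x] has length 0.   *)
Definition isometric_path (s : seq T) : bool :=
  if s is x :: p then
    [&& path e x p, uniq (x :: p) & size p == dist x (last x p)]
  else false.

(* Duplicate-free sequences have size at most #|T|, so #|T|.-bseq T contains  *)
(* every path. A path and its reversal are distinct members of this type;     *)
(* this does not affect the minima below.                                     *)
Definition isometric_path_cover (F : {set #|T|.-bseq T}) : bool :=
  [forall s in F, isometric_path s] && [forall v, exists s in F, v \in s].

Definition isometric_path_partition (F : {set #|T|.-bseq T}) : bool :=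
  [forall s in F, isometric_path s]
  && [forall v, #|[set s in F | v \in s]| == 1].

Definition has_cover_of_card (k : nat) : bool :=
  [exists F, isometric_path_cover F && (#|F| == k)].

Definition has_partition_of_card (k : nat) : bool :=
  [exists F, isometric_path_partition F && (#|F| == k)].

Lemma dist_refl x : dist x x = 0.
Proof.
rewrite /dist; have : 0 < #|T| by apply/card_gt0P; exists x.
case: #|T| => // n _ /=; case: ifP => // /existsP[].
by exists [tuple]; rewrite /= eqxx.
Qed.

Lemma partition_is_cover F :
  isometric_path_partition F -> isometric_path_cover F.
Proof.
move=> /andP[isoF /forallP partF]; rewrite /isometric_path_cover isoF /=.
apply/forallP => v; have /cards1P[s Es] := partF v.
have : s \in [set s in F | v \in s] by rewrite Es set11.
by rewrite inE => sFv; apply/existsP; exists s.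
Qed.

Lemma singletons_partition :
  isometric_path_partition [set s : #|T|.-bseq T | size s == 1].
Proof.
apply/andP; split.
  apply/forall_inP => s; rewrite inE => /eqP.
  by case: s => -[|x [|y s]] //= _ _; rewrite dist_refl.
apply/forallP => v; apply/cards1P.
have T0 : size [:: v] <= #|T| by apply/card_gt0P; exists v.
exists (Bseq T0); apply/setP => s; rewrite !inE -val_eqE /=.
case: s => -[|x [|y p]] _ //=.
by rewrite eqseq_cons andbF.
Qed.

Lemma ex_partition : exists k, has_partition_of_card k.
Proof.
exists #|[set s : #|T|.-bseq T | size s == 1]|.
apply/existsP; exists [set s : #|T|.-bseq T | size s == 1].
by rewrite singletons_partition eqxx.
Qed.

Lemma ex_cover : exists k, has_cover_of_card k.
Proof.
have [k /existsP[F /andP[/partition_is_cover cF kF]]] := ex_partition.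
by exists k; apply/existsP; exists F; rewrite cF.
Qed.

Definition ip_c : nat := ex_minn ex_cover.
Definition ip_p : nat := ex_minn ex_partition.

End IsometricPaths.

Definition path_graph (r : nat) : rel 'I_r :=
  fun i j => (i.+1 == j :> nat) || (j.+1 == i :> nat).
Arguments path_graph : clear implicits.

(* ordS is the cyclic successor; this is the cycle on s vertices for s >= 3.  *)
Definition cycle_graph (s : nat) : rel 'I_s :=
  fun i j => (j == ordS i) || (i == ordS j).
Arguments cycle_graph : clear implicits.

Definition cartesian_product (T U : finType) (e : rel T) (f : rel U) :
    rel (T * U) :=
  fun x y => ((x.1 == y.1) && f x.2 y.2) || (e x.1 y.1 && (x.2 == y.2)).

(* Main.v *)
Require Import Defs.
From mathcomp Require Import all_boot zify.

Set Implicit Arguments.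
Unset Strict Implicit.
Unset Printing Implicit Defensive.

(** Each copy of [P_r] is an isometric path, and these [s] copies partition the
    cylinder.  Conversely, every isometric path has at most [r + s %/ 2]
    vertices because the cylinder has diameter at most [r - 1 + s %/ 2], so
    [s - 1] of them cover at most [(s - 1) * (r + s %/ 2) < r * s] vertices. *)

(** * Walks, distance and covers in an arbitrary graph *)

Section Walks.
Variables (T : finType) (e : rel T).

(** Vertices may repeat and the length is only bounded, so that walks can be concatenated freely;
    this is all that upper bounds on [dist] require. *)
Definition walk_le (n : nat) (x y : T) : Prop :=
  exists2 p, path e x p & last x p = y /\ size p <= n.

Lemma walk_le_refl n x : walk_le n x x.
Proof. by exists [::]. Qed.

Lemma walk_le_edge x y : e x y -> walk_le 1 x y.
Proof. by move=> exy; exists [:: y]; rewrite //= exy. Qed.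

Lemma walk_le_trans m n x y z :
  walk_le m x y -> walk_le n y z -> walk_le (m + n) x z.
Proof.
move=> [p ep [<- pm]] [q eq [<- qn]]; exists (p ++ q).
  by rewrite cat_path ep.
by rewrite last_cat size_cat leq_add.
Qed.

Lemma walk_le_weaken m n x y : m <= n -> walk_le m x y -> walk_le n x y.
Proof. by move=> mn [p ep [py pm]]; exists p => //; split=> //; lia. Qed.

Lemma walk_le_sym n x y : symmetric e -> walk_le n x y -> walk_le n y x.
Proof.
move=> e_sym [p ep [<- pn]]; exists (rev (belast x p)).
  by rewrite rev_path (eq_path (e' := e)) // => u v; rewrite e_sym.
rewrite size_rev size_belast; split=> //.
by case: p {ep pn} => //= y' p; rewrite rev_cons last_rcons.
Qed.

Lemma dist_le_walk n x y : walk_le n x y -> dist e x y <= n.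
Proof.
move=> [p ep [<- pn]]; apply: leq_trans pn; rewrite /dist.
(* A walk of length at least [#|T|] proves the bound trivially, since [find] never exceeds [#|T|]. A
   shorter one satisfies the test at index [size p]. *)
set a := (X in find X _); have [pT|Tp] := ltnP (size p) #|T|; last first.
  by apply: leq_trans Tp; rewrite -[leqRHS](size_iota 0); apply: find_size.
rewrite leqNgt; apply/negP => /(before_find 0); rewrite nth_iota // add0n.
by move/negbT/negP; apply; apply/existsP; exists (in_tuple p); rewrite ep eqxx.
Qed.

Lemma size_isometric_path n (t : seq T) :
  (forall x y, walk_le n x y) -> isometric_path e t -> size t <= n.+1.
Proof.
move=> diam; case: t => //= x p /and3P[_ _ /eqP ->].
by rewrite ltnS; apply: dist_le_walk.
Qed.

Lemma path_height (h : T -> nat) x p :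
  (forall u v, e u v -> h v <= (h u).+1) ->
  path e x p -> h (last x p) <= h x + size p.
Proof.
move=> h_step; elim: p x => [|y p IHp] x /=; first by rewrite addn0.
by move=> /andP[/h_step exy /IHp]; lia.
Qed.

(** The height [h] certifies minimality: it gains at most one per edge, so any walk joining the same
    ends has at least [size p] edges. *)
Lemma isometric_path_height (h : T -> nat) x p :
  (forall u v, e u v -> h v <= (h u).+1) ->
  path e x p -> uniq (x :: p) -> h (last x p) = h x + size p ->
  isometric_path e (x :: p).
Proof.
move=> h_step ep xp_uniq hp; rewrite /isometric_path ep xp_uniq /= eqn_leq.
rewrite dist_le_walk ?andbT; last by exists p.
rewrite /dist; set a := (X in find X _).
(* If the search failed, [dist] would take its default [#|T|], which exceeds [size p] because
   [x :: p] is duplicate-free. *)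
have [a_has|/hasNfind ->] := boolP (has a (iota 0 #|T|)); last first.
  rewrite size_iota ltnW // -[(size p).+1]/(size (x :: p)).
  by rewrite -(card_uniqP xp_uniq) max_card.
have := nth_find 0 a_has; rewrite nth_iota ?add0n; last first.
  by rewrite -{2}(size_iota 0 #|T|) -has_find.
case/existsP=> q /andP[/(path_height h_step) + /eqP lq].
by rewrite lq hp size_tuple leq_add2l.
Qed.

Lemma card_isometric_path_cover m (F : {set #|T|.-bseq T}) :
  (forall t, isometric_path e t -> size t <= m) ->
  isometric_path_cover e F -> #|T| <= #|F| * m.
Proof.
move=> size_le /andP[/forall_inP isoF /forallP covF].
have /subset_leq_card : [set: T] \subset \bigcup_(t in F) [set v in t].
  apply/subsetP => v _; have /exists_inP[t Ft vt] := covF v.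
  by apply/bigcupP; exists t; rewrite ?inE.
rewrite cardsT => /leq_trans; apply; rewrite -sum_nat_const.
(* The invariant bounds the cardinality of each partial union by the matching partial sum. *)
elim/big_ind2: _ => [|A a B b Aa Bb|t /isoF /size_le]; first by rewrite cards0.
  by apply: leq_trans (leq_add Aa Bb); rewrite cardsU leq_subr.
by apply: leq_trans; rewrite cardsE card_size.
Qed.

End Walks.

Lemma map_walk_le (T U : finType) (e : rel T) (f : rel U) (g : T -> U) n x y :
  {homo g : u v / e u v >-> f u v} ->
  walk_le e n x y -> walk_le f n (g x) (g y).
Proof.
move=> homo_g [p ep [<- pn]]; exists (map g p).
  exact: (homo_path homo_g).
by rewrite last_map size_map.
Qed.

(** * Diameter bounds for the path and the cycle *)

Lemma path_graph_sym r : symmetric (path_graph r).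
Proof. by move=> i j; rewrite /path_graph orbC. Qed.

Lemma cycle_graph_sym s : symmetric (cycle_graph s).
Proof. by move=> i j; rewrite /cycle_graph orbC. Qed.

Lemma path_graph_walk r (i j : 'I_r) : walk_le (path_graph r) r.-1 i j.
Proof.
wlog le_ij : i j / i <= j => [wlog_ij|].
  have [/wlog_ij //|/ltnW/wlog_ij] := leqP i j.
  exact: (walk_le_sym (@path_graph_sym r)).
have: walk_le (path_graph r) (j - i) i j; last first.
  by apply: walk_le_weaken; have := ltn_ord j; lia.
have [d jd] : exists d, d = j - i by exists (j - i).
rewrite -jd; elim: d j le_ij jd => [|d IHd] j le_ij jd.
  suff -> : i = j by apply: walk_le_refl.
  by apply: val_inj => /=; lia.
(* Here [j - i = d.+1], so [j] is positive and [j.-1] is its true predecessor, still at least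
   [i]. *)
have j'r : j.-1 < r by have := ltn_ord j; lia.
rewrite -addn1; apply: (@walk_le_trans _ _ _ _ _ (Ordinal j'r)).
  by apply: IHd => /=; lia.
by apply: walk_le_edge; rewrite /path_graph /=; lia.
Qed.

Lemma iter_ordS s (i j : 'I_s) d :
  j = (i + d) %% s :> nat -> j = iter d (@ordS s) i.
Proof.
move=> jE; apply: val_inj; rewrite /= jE; elim: d {j jE} => [|d IHd] /=.
  by rewrite addn0 modn_small.
by rewrite -IHd addnS -[X in X %% s = _]addn1 -[X in _ = X %% s]addn1 modnDml.
Qed.

Lemma walk_iter_ordS s (i : 'I_s) d :
  walk_le (cycle_graph s) d i (iter d (@ordS s) i).
Proof.
elim: d => [|d IHd]; first exact: walk_le_refl.
rewrite -{1}[d.+1]addn1; apply: (walk_le_trans IHd).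
by apply: walk_le_edge; rewrite /cycle_graph eqxx.
Qed.

(** For [i <= j], the two arcs have lengths [j - i] and [s - (j - i)], and the smaller is at most
    [s %/ 2]. *)
Lemma cycle_graph_walk s (i j : 'I_s) : walk_le (cycle_graph s) (s %/ 2) i j.
Proof.
wlog le_ij : i j / i <= j => [wlog_ij|].
  have [/wlog_ij //|/ltnW/wlog_ij] := leqP i j.
  exact: (walk_le_sym (@cycle_graph_sym s)).
have js := ltn_ord j.
have [short|long] := leqP (j - i) (s %/ 2).
  apply: walk_le_weaken short _.
  rewrite [j in walk_le _ _ _ j](@iter_ordS s i j (j - i)).
    exact: walk_iter_ordS.
  by rewrite subnKC // modn_small.
(* The other arc runs forward from [j], wraps past [0] and ends at [i], so it is traversed in
   reverse. *)
apply: (walk_le_sym (@cycle_graph_sym s)).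
apply: (@walk_le_weaken _ _ (s - (j - i))); first by lia.
rewrite [i in walk_le _ _ _ i](@iter_ordS s j i (s - (j - i))).
  exact: walk_iter_ordS.
have -> : j + (s - (j - i)) = i + s by lia.
by rewrite modnDr modn_small.
Qed.

(** * Diameter and columns of the cylinder *)

Section Cylinder.
Variables r s : nat.
Let cylinder := cartesian_product (path_graph r) (cycle_graph s).

Lemma cylinder_walk (x y : 'I_r * 'I_s) :
  walk_le cylinder (r.-1 + s %/ 2) x y.
Proof.
(* The walk first moves inside a copy of the path, then inside a copy of the cycle. *)
case: x y => [i j] [i' j']; apply: (walk_le_trans (y := (i', j))).
  apply: (map_walk_le (g := fun k => (k, j)) _ (path_graph_walk i i')).
  by move=> u v uv; rewrite /cylinder /cartesian_product /= uv eqxx orbT.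
apply: (map_walk_le (g := fun k => (i', k)) _ (cycle_graph_walk j j')).
by move=> u v uv; rewrite /cylinder /cartesian_product /= uv eqxx.
Qed.

Definition column (j : 'I_s) : seq ('I_r * 'I_s) :=
  [seq (i, j) | i <- enum 'I_r].

Lemma mem_column v j : (v \in column j) = (v.2 == j).
Proof.
apply/mapP/eqP => [[i _ ->] //|<-]; exists v.1; first by rewrite mem_enum.
by case: v.
Qed.

Lemma uniq_column j : uniq (column j).
Proof. by rewrite map_inj_uniq ?enum_uniq // => i i' [->]. Qed.

Lemma size_column_le j : size (column j) <= #|{: 'I_r * 'I_s}|.
Proof. by rewrite -(card_uniqP (uniq_column j)) max_card. Qed.

Definition bcolumn j : #|{: 'I_r * 'I_s}|.-bseq ('I_r * 'I_s) :=
  Bseq (size_column_le j).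

Lemma sorted_column j : sorted cylinder (column j).
Proof.
apply: (homo_sorted (e := path_graph r)) => [u v uv|].
  by rewrite /cylinder /cartesian_product /= uv eqxx orbT.
(* Adjacency in the path depends only on the underlying numbers, and those of [enum 'I_r] form
   [iota 0 r]. *)
have: sorted (fun m n => (m.+1 == n) || (n.+1 == m)) (iota 0 r).
  by case: r => //= r'; elim: r' 0 => //= r' IHr m; rewrite eqxx IHr.
by rewrite -val_enum_ord sorted_map.
Qed.

(** The first coordinate serves as height: it changes by at most one along each edge and climbs from
    [0] to [r.-1] along the column. *)
Lemma isometric_column j : 0 < r -> isometric_path cylinder (column j).
Proof.
move=> r0; have sz : size (column j) = r by rewrite size_map size_enum_ord.
have nthE n : n < r -> (nth (Ordinal r0, j) (column j) n).1 = n :> nat.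
  move=> nr; rewrite (nth_map (Ordinal r0)) ?size_enum_ord //=.
  exact: nth_enum_ord.
have := sorted_column j; have := uniq_column j.
case: (column j) sz nthE => [|x p] sz nthE xp_uniq ep.
  by exfalso; rewrite /= in sz; lia.
apply: (isometric_path_height (h := fun v : 'I_r * 'I_s => v.1 : nat)) => //.
  move=> [a b] [a' b']; rewrite /cylinder /cartesian_product /path_graph /=.
  by case/orP=> /andP[]; [move=> /eqP -> | case/orP=> /eqP]; lia.
have /= -> := nthE 0 r0; rewrite /= in sz.
have := nthE (size p); rewrite -[size p]/(size (x :: p)).-1 nth_last /=.
by apply; lia.
Qed.

(** The vertex in row [0] tells the columns apart; for [r = 0] all columns would be empty and hence
    equal. *)
Lemma bcolumn_inj : 0 < r -> injective bcolumn.
Proof.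
move=> r0 j j' /(congr1 val) /= jj'; apply/eqP.
have := mem_column (Ordinal r0, j) j'; rewrite -jj' mem_column /=.
by rewrite eqxx => <-.
Qed.

Lemma columns_partition :
  0 < r -> isometric_path_partition cylinder [set bcolumn j | j : 'I_s].
Proof.
move=> r0; apply/andP; split.
  by apply/forall_inP => t /imsetP[j _ ->]; apply: isometric_column.
apply/forallP => v; apply/cards1P; exists (bcolumn v.2).
apply/setP => t; rewrite !inE; apply/andP/eqP => [[/imsetP[j _ ->]]|->].
  by rewrite /= mem_column => /eqP ->.
by rewrite imset_f //= mem_column.
Qed.

Lemma cylinder_cover_card F :
  0 < r -> 1 < s -> s %/ 2 * s <= r ->
  isometric_path_cover cylinder F -> s <= #|F|.
Proof.
move=> r0 s1 hrs /(card_isometric_path_cover (m := (r.-1 + s %/ 2).+1)) cardF.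
have: r * s <= #|F| * (r + s %/ 2).
  have -> : r + s %/ 2 = (r.-1 + s %/ 2).+1 by lia.
  have := cardF (fun t => size_isometric_path cylinder_walk).
  by rewrite {1}card_prod !card_ord.
(* With [k = s %/ 2], positivity gives [(s - 1) * k < k * s <= r], hence
   [(s - 1) * (r + k) < r * s], which excludes [#|F| <= s - 1]. *)
have: 0 < s %/ 2 by lia.
by move: (s %/ 2) hrs => k; nia.
Qed.

End Cylinder.

Theorem theorem7 (r s : nat) (hr : 1 <= r) (hs : 3 <= s)
    (hrs : s %/ 2 * s <= r) :
  ip_p (cartesian_product (path_graph r) (cycle_graph s)) =
    ip_c (cartesian_product (path_graph r) (cycle_graph s)) /\
  ip_c (cartesian_product (path_graph r) (cycle_graph s)) = s.
Proof.
have columnsP := columns_partition s hr.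
have cardC : #|[set @bcolumn r s j | j : 'I_s]| = s.
  by rewrite card_imset ?card_ord //; apply: bcolumn_inj.
have lower F := @cylinder_cover_card _ _ F hr (ltnW hs) hrs.
suff [-> ->] : ip_p (cartesian_product (path_graph r) (cycle_graph s)) = s /\
  ip_c (cartesian_product (path_graph r) (cycle_graph s)) = s by [].
split; rewrite /ip_p /ip_c; case: ex_minnP => k /existsP[F /andP[FP /eqP <-]].
  (* A minimum partition is also a cover, so the counting bound applies to it; the columns give the
     reverse inequality. *)
  move=> min; apply/eqP; rewrite eqn_leq lower ?partition_is_cover // andbT.
  apply: min; apply/existsP; exists [set @bcolumn r s j | j : 'I_s].
  by rewrite columnsP cardC eqxx.
move=> min; apply/eqP; rewrite eqn_leq lower // andbT.
apply: min; apply/existsP; exists [set @bcolumn r s j | j : 'I_s].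
by rewrite partition_is_cover // cardC eqxx.
Qed.
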